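(* Let $G$ be a finite acyclic directed graph and let $\preceq$ be a linear order on its edge set $E(G)$ (with strict part $\prec$). Then $\preceq$ satisfies conditions $(U_1)$, $(U_2)$, $(U_3)$ below if and only if it satisfies conditions $(Q_1)$, $(Q_2)$ below. $(U_1)$ For edges $e_1,e_2$, $e_1\to e_2$ implies $e_1\prec e_2$. $(U_2)$ For every vertex $v$, $\overline{I(v)}\cap\overline{O(v)}=\emptyset$ and $\overline{E(v)}=\overline{I(v)}\sqcup\overline{O(v)}$. $(U_3)$ For any two vertices $v_1,v_2$: $I(v_1)\cap\overline{I(v_2)}\neq\emptyset$ implies $\overline{I(v_1)}\subseteq\overline{I(v_2)}$, and $O(v_1)\cap\overline{O(v_2)}\neq\emptyset$ implies $\overline{O(v_1)}\subseteq\overline{O(v_2)}$. $(Q_1)$ For edges $e_1,e_2$, $e_1\to e_2$ implies $e_1\prec e_2$. $(Q_2)$ If $e_1\prec e\prec e_2$ and $e_1,e_2$ are adjacent (share an endpoint), then: if $t(e_1)=t(e_2)=v$, then $I(t(e))\subseteq\overline{I(v)}$; if $s(e_1)=s(e_2)=v$, then $O(s(e))\subseteq\overline{O(v)}$; if $t(e_1)=s(e_2)=v$, then either $I(t(e))\subseteq\overline{I(v)}$ or $O(s(e))\subseteq\overline{O(v)}$.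
   Context: Directed graphs are finite and may have multiple edges; each edge $e$ has a source $s(e)$ and a target $t(e)$. For a vertex $v$, $I(v)$ is the set of incoming edges (edges with target $v$), $O(v)$ the set of outgoing edges (edges with source $v$), and $E(v)=I(v)\cup O(v)$. For edges $e_1,e_2$, $e_1\to e_2$ means there is a directed path starting with the edge $e_1$ and ending with the edge $e_2$ (the reachable order). For a subset $X$ of a finite linearly ordered set $(S,\preceq)$, $\overline{X}=\{y\in S: \min X\preceq y\preceq \max X\}$ is its convex hull (empty if $X$ is empty). *)

(* Defs.v *)
From mathcomp Require Import all_boot all_order.
Set Implicit Arguments.
Unset Strict Implicit.
Unset Printing Implicit Defensive.
Import Order.TTheory.
Local Open Scope order_scope.

Record digraph (V E : finType) := Digraph { src : E -> V; tgt : E -> V }.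

Definition in_edges (V E : finType) (G : digraph V E) (v : V) : {set E} :=
  [set e | tgt G e == v].

Definition out_edges (V E : finType) (G : digraph V E) (v : V) : {set E} :=
  [set e | src G e == v].

Definition inc_edges (V E : finType) (G : digraph V E) (v : V) : {set E} :=
  in_edges G v :|: out_edges G v.

Definition consecutive (V E : finType) (G : digraph V E) : rel E :=
  fun e1 e2 => tgt G e1 == src G e2.

(* [cycle] accepts the empty sequence, hence the conclusion; a nonempty [c]
   is a directed closed walk, given by its edges. *)
Definition acyclic (V E : finType) (G : digraph V E) : Prop :=
  forall c : seq E, cycle (consecutive G) c -> c = [::].

(* The path has at least two edges: the relation is the strict reachable order,
   so that "e1 reaches e2 implies e1 < e2" does not demand e < e. *)
Definition reaches (V E : finType) (G : digraph V E) (e1 e2 : E) : Prop :=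
  exists p : seq E,
    [/\ p != [::], path (consecutive G) e1 p & last e1 p = e2].

Definition adjacent (V E : finType) (G : digraph V E) (e1 e2 : E) : Prop :=
  exists v : V, e1 \in inc_edges G v /\ e2 \in inc_edges G v.

(* [x0] only witnesses that [X] is nonempty; min and max do not depend on it. *)
Definition hull (d : Order.disp_t) (S : finOrderType d) (X : {set S}) : {set S} :=
  if [pick x in X] is Some x0 then
    [set y | [arg min_(x < x0 in X) x] <= y <= [arg max_(x > x0 in X) x]]
  else set0.

Section EdgeOrderConditions.
Variables (d : Order.disp_t) (V : finType) (E : finOrderType d).
Variable G : digraph V E.

Definition U1 : Prop := forall e1 e2 : E, reaches G e1 e2 -> e1 < e2.

Definition U2 : Prop := forall v : V,
  hull (in_edges G v) :&: hull (out_edges G v) = set0 /\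
  hull (inc_edges G v) = hull (in_edges G v) :|: hull (out_edges G v).

Definition U3 : Prop := forall v1 v2 : V,
  (in_edges G v1 :&: hull (in_edges G v2) != set0 ->
     hull (in_edges G v1) \subset hull (in_edges G v2)) /\
  (out_edges G v1 :&: hull (out_edges G v2) != set0 ->
     hull (out_edges G v1) \subset hull (out_edges G v2)).

Definition Q1 : Prop := forall e1 e2 : E, reaches G e1 e2 -> e1 < e2.

Definition Q2 : Prop := forall e1 e e2 : E,
  e1 < e -> e < e2 -> adjacent G e1 e2 ->
  forall v : V,
  [/\ tgt G e1 = v -> tgt G e2 = v ->
        in_edges G (tgt G e) \subset hull (in_edges G v),
      src G e1 = v -> src G e2 = v ->
        out_edges G (src G e) \subset hull (out_edges G v)
    & tgt G e1 = v -> src G e2 = v ->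
        in_edges G (tgt G e) \subset hull (in_edges G v) \/
        out_edges G (src G e) \subset hull (out_edges G v)].

End EdgeOrderConditions.

(* Main.v *)
Require Import Defs.
From mathcomp Require Import all_boot all_order.

Import Order.TTheory.
Local Open Scope order_scope.

Section Hull.
Context {d : Order.disp_t} {S : finOrderType d}.
Implicit Types (X Y : {set S}) (y : S).

(** [U1] and [Q1] are the same condition, so the content is how [U2] and [U3] relate to [Q2]. The
    two same-end clauses of [Q2] amount to [U3]: both say that a fibre of [tgt] or [src] meeting the
    hull of another fibre lies inside it ([fibre_hullP]). The mixed clause matches the covering half
    of [U2]: an edge between an incoming and an outgoing edge of $v$ lies in $\overline{E(v)}$,
    hence in one of the two hulls, and nesting carries its whole fibre along ([U_Q2]). Conversely,
    such an edge belongs to its own fibres, so the mixed clause places it in one of the hulls, while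
    [Q1] keeps the hulls disjoint ([Q_U2]). *)

(** Replaces min and max by arbitrary bracketing elements of [X]; for empty [X] there are none. *)
Lemma hullP X y :
  reflect (exists a b, [/\ a \in X, b \in X, a <= y & y <= b]) (y \in hull X).
Proof.
rewrite /hull; case: pickP => [x0 x0X | X0]; last first.
  by rewrite inE; constructor=> -[a [b [aX]]]; rewrite X0 in aX.
rewrite inE; case: arg_minP => // m mX m_min; case: arg_maxP => // M MX M_max.
apply: (iffP andP) => [[my yM] | [a [b [aX bX ay yb]]]]; first by exists m, M.
by split; [apply: le_trans (m_min a aX) ay | apply: le_trans yb (M_max b bX)].
Qed.

Lemma sub_hull X : X \subset hull X.
Proof. by apply/subsetP=> y yX; apply/hullP; exists y, y. Qed.

Lemma hull_min X Y : X \subset hull Y -> hull X \subset hull Y.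
Proof.
move=> /subsetP sXY; apply/subsetP=> y /hullP[a [b [aX bX ay yb]]].
have /hullP[a' [_ [a'Y _ a'a _]]] := sXY a aX.
have /hullP[_ [b' [_ b'Y _ bb']]] := sXY b bX.
by apply/hullP; exists a', b'; split; [| | apply: le_trans ay | apply: le_trans bb'].
Qed.

Lemma hullS X Y : X \subset Y -> hull X \subset hull Y.
Proof. by move=> sXY; apply/hull_min/(subset_trans sXY)/sub_hull. Qed.

(* Applied with [f] the target and source maps, whose fibres are the sets of
   incoming and outgoing edges. *)
Lemma fibre_hullP (V : finType) (f : S -> V) :
  (forall e1 e e2, e1 < e -> e < e2 -> f e1 = f e2 ->
     [set x | f x == f e] \subset hull [set x | f x == f e2]) <->
  (forall v1 v2, [set x | f x == v1] :&: hull [set x | f x == v2] != set0 ->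
     hull [set x | f x == v1] \subset hull [set x | f x == v2]).
Proof.
split=> [nested v1 v2 /set0Pn[e] | nested e1 e e2 lt1 lt2 eq12].
  rewrite 2!inE => /andP[/eqP<- /hullP[a [b []]]].
  rewrite !inE => /eqP fa /eqP fb.
  (* If [e] equals a bracketing element, the two fibres coincide; otherwise both inequalities are
     strict, as [nested] requires. *)
  rewrite le_eqVlt => /predU1P[<- _ | ae]; first by rewrite fa.
  rewrite le_eqVlt => /predU1P[-> | eb]; first by rewrite fb.
  by apply: hull_min; rewrite -fb; apply: nested ae eb _; rewrite fa.
apply: subset_trans (sub_hull _) (nested _ _ _); apply/set0Pn; exists e.
rewrite 2!inE eqxx /=; apply/hullP; exists e1, e2.
by rewrite !inE eq12 eqxx !ltW.
Qed.

End Hull.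

Section EdgeOrder.
Context {d : Order.disp_t} {V : finType} {E : finOrderType d}.
Variable G : digraph V E.

(** The two edges form a directed path through [v]. *)
Lemma in_lt_out {v : V} {a b : E} :
  Q1 G -> a \in in_edges G v -> b \in out_edges G v -> a < b.
Proof.
rewrite !inE => q1 /eqP ta /eqP sb; apply: q1; exists [:: b]; split=> //=.
by rewrite /consecutive ta sb eqxx.
Qed.

Lemma U_Q2 : U2 G -> U3 G -> Q2 G.
Proof.
move=> u2 u3 e1 e e2 lt1 lt2 _ v.
have nest_in := (fibre_hullP V (tgt G)).2 (fun v1 v2 => (u3 v1 v2).1).
have nest_out := (fibre_hullP V (src G)).2 (fun v1 v2 => (u3 v1 v2).2).
split=> [t1 t2 | s1 s2 | t1 s2].
- by rewrite -t2; apply: nest_in lt1 lt2 _; rewrite t1.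
- by rewrite -s2; apply: nest_out lt1 lt2 _; rewrite s1.
have : e \in hull (inc_edges G v).
  apply/hullP; exists e1, e2.
  by rewrite !inE t1 s2 eqxx orbT !ltW.
(* In either case [e] itself witnesses that its fibre meets the hull, so [U3] applies. *)
rewrite (u2 v).2 => /setUP[eI | eO]; [left | right].
  apply: subset_trans (sub_hull _) ((u3 _ _).1 _).
  by apply/set0Pn; exists e; rewrite inE eI andbT inE.
apply: subset_trans (sub_hull _) ((u3 _ _).2 _).
by apply/set0Pn; exists e; rewrite inE eO andbT inE.
Qed.

Lemma Q_U2 : Q1 G -> Q2 G -> U2 G.
Proof.
move=> q1 q2 v; split.
  (* A common point would lie below some incoming edge and above some outgoing one, against
     [in_lt_out]. *)
  apply/eqP/set0Pn => -[y /setIP[]].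
  move=> /hullP[_ [b [_ bI _ yb]]] /hullP[c [_ [cO _ cy _]]].
  have := lt_le_trans (in_lt_out q1 bI cO) (le_trans cy yb).
  by rewrite ltxx.
apply/eqP; rewrite eqEsubset; apply/andP; split; last first.
  by rewrite subUset !hullS ?subsetUl ?subsetUr.
apply/subsetP=> y /hullP[a [b [aE bE ay yb]]]; apply/setUP.
case/setUP: (aE) => aX; case/setUP: (bE) => bX.
- by left; apply/hullP; exists a, b.
(* The mixed case: [Q2] needs strict inequalities, so the endpoints [a] and [b] are treated
   apart. *)
- move: ay; rewrite le_eqVlt => /predU1P[<- | ay].
    by left; apply: (subsetP (sub_hull _)).
  move: yb; rewrite le_eqVlt => /predU1P[-> | yb].
    by right; apply: (subsetP (sub_hull _)).
  have adj : adjacent G a b by exists v.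
  have [_ _ nested] := q2 a y b ay yb adj v.
  move: aX bX; rewrite !inE => /eqP ta /eqP sb.
  by case: (nested ta sb) => /subsetP s; [left | right]; apply: s; rewrite inE.
(* Here [a] is outgoing and [b] incoming, so [b < a], contradicting [a <= y <= b]. *)
- have := lt_le_trans (in_lt_out q1 bX aX) (le_trans ay yb).
  by rewrite ltxx.
by right; apply/hullP; exists a, b.
Qed.

(** Edges with a common target or a common source are adjacent, so the first two clauses of [Q2]
    supply the hypothesis of [fibre_hullP]. *)
Lemma Q2_U3 : Q2 G -> U3 G.
Proof.
move=> q2 v1 v2; split; apply: (fibre_hullP V _).1 => e1 e e2 lt1 lt2 eq12.
  have adj : adjacent G e1 e2 by exists (tgt G e2); rewrite !inE eq12 eqxx.
  by have [+ _ _] := q2 e1 e e2 lt1 lt2 adj (tgt G e2); apply.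
have adj : adjacent G e1 e2.
  by exists (src G e2); rewrite !inE eq12 eqxx !orbT.
by have [_ + _] := q2 e1 e e2 lt1 lt2 adj (src G e2); apply.
Qed.

End EdgeOrder.

Theorem theorem2p4 (d : Order.disp_t) (V : finType) (E : finOrderType d)
    (G : digraph V E) (HG : acyclic G) :
  (U1 G /\ U2 G /\ U3 G) <-> (Q1 G /\ Q2 G).
Proof.
split=> [[u1 [u2 u3]] | [q1 q2]]; first by split=> //; apply: U_Q2.
by split=> //; split; [apply: Q_U2 | apply: Q2_U3].
Qed.
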